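(* Let $p$ be an odd prime and let $R_p$ be the dihedral quandle on $\mathbb{Z}_p$. Then for every $n\ge 3$ the rack homology group $H_n^R(R_p)$ contains $\mathbb{Z}_p$, i.e. it has a subgroup isomorphic to $\mathbb{Z}_p$.
   Context: $\mathbb{Z}_k=\mathbb{Z}/k\mathbb{Z}$. The dihedral quandle $R_k$ is the set $\mathbb{Z}_k$ with the operation $a*b=2b-a$. For a rack $X$ (a set with a binary operation $*$ such that for every $b$ the map $a\mapsto a*b$ is a bijection and $(a*b)*c=(a*c)*(b*c)$ for all $a,b,c$), the rack chain complex is defined as follows. For $n\ge 1$, $C_n^R(X)$ is the free abelian group generated by $n$-tuples $(x_1,\dots,x_n)$ of elements of $X$, with boundary homomorphism $\partial: C^R_n(X)\to C^R_{n-1}(X)$, $$\partial(x_1,\ldots,x_n)=\sum_{i=2}^n(-1)^i\big((x_1,\ldots,x_{i-1},x_{i+1},\ldots,x_n)-(x_1*x_i,\ldots,x_{i-1}*x_i,x_{i+1},\ldots,x_n)\big)$$ (so $\partial=0$ on $C_1^R(X)$). Rack homology $H_n^R(X)$ is the homology of $(C_*^R(X),\partial)$. *)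

(* Defs.v *)
From HB Require Import structures.
From mathcomp Require Import all_boot all_algebra.
From mathcomp Require Import ring boolp freeg.

Set Implicit Arguments.
Unset Strict Implicit.
Unset Printing Implicit Defensive.

Import GRing.Theory.
Local Open Scope ring_scope.

HB.mixin Record isRack X := {
  rack_op : X -> X -> X;
  rack_op_bij : forall b : X, bijective (fun a => rack_op a b);
  rack_opDr : forall a b c : X,
    rack_op (rack_op a b) c = rack_op (rack_op a c) (rack_op b c)
}.

#[short(type="rackType")]
HB.structure Definition Rack := {X of isRack X & Choice X}.

(* As always with 'Z_k, this is the ring of integers mod k only for k >= 2. *)
Definition dihedral (k : nat) : Type := 'Z_k.

HB.instance Definition _ (k : nat) := Choice.copy (dihedral k) 'Z_k.

Section DihedralQuandle.
Variable k : nat.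

Definition dihedral_op (a b : dihedral k) : dihedral k :=
  2 * (b : 'Z_k) - (a : 'Z_k).

Lemma dihedral_op_bij b : bijective (fun a => dihedral_op a b).
Proof. by exists (fun a => dihedral_op a b) => a; rewrite /dihedral_op subKr. Qed.

Lemma dihedral_opDr a b c :
  dihedral_op (dihedral_op a b) c =
  dihedral_op (dihedral_op a c) (dihedral_op b c).
Proof. by rewrite /dihedral_op; ring. Qed.

HB.instance Definition _ :=
  isRack.Build (dihedral k) dihedral_op_bij dihedral_opDr.

End DihedralQuandle.

Section RackHomology.
Variable X : rackType.

(* The degree 0 chain group is int rather than absent; this is harmless in    *)
(* degrees n >= 1, as the boundary out of degree 1 is zero (empty sum below). *)
Definition rack_chain (n : nat) : lmodType int := {freeg (n.-tuple X) / int}.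

(* fintype.lift i : 'I_n.-1 -> 'I_n enumerates increasingly the indices other *)
(* than i; the qualification is needed because freeg also defines lift.       *)
Definition face0 n (i : 'I_n) (x : n.-tuple X) : n.-1.-tuple X :=
  [tuple tnth x (fintype.lift i j) | j < n.-1].

Definition face1 n (i : 'I_n) (x : n.-tuple X) : n.-1.-tuple X :=
  [tuple if (j < i)%N then rack_op (tnth x (fintype.lift i j)) (tnth x i)
         else tnth x (fintype.lift i j) | j < n.-1].

(* Indices are counted from 0, so that the summation range 2 <= i <= n of the *)
(* usual 1-based formula is 1 <= i < n, and its sign (-1) ^ i is (-1) ^ i.+1. *)
Definition rack_boundary_gen n (x : n.-tuple X) : rack_chain n.-1 :=
  \sum_(i < n | (0 < i)%N) (-1) ^+ i.+1 *: (<< face0 i x >> - << face1 i x >>).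

Definition rack_boundary n : rack_chain n -> rack_chain n.-1 :=
  fglift (@rack_boundary_gen n).

Lemma rack_boundary_is_zmod_morphism n : zmod_morphism (@rack_boundary n).
Proof. exact: lift_is_additive. Qed.

HB.instance Definition _ n := GRing.isZmodMorphism.Build
  (rack_chain n) (rack_chain n.-1) (@rack_boundary n)
  (@rack_boundary_is_zmod_morphism n).

Definition rack_cycle_pred n : {pred rack_chain n} :=
  fun c => rack_boundary c == 0.

Lemma rack_cycle_zmod_closed n : zmod_closed (@rack_cycle_pred n).
Proof.
split=> [|c d]; rewrite /in_mem /= /rack_cycle_pred ?raddf0 //.
by move=> /eqP bc /eqP bd; rewrite raddfB /= bc bd subrr.
Qed.

HB.instance Definition _ n := GRing.isZmodClosed.Build (rack_chain n)
  (@rack_cycle_pred n) (@rack_cycle_zmod_closed n).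

Definition rack_cycle n : Type := {c : rack_chain n | rack_cycle_pred c}.

HB.instance Definition _ n := Choice.on (rack_cycle n).
HB.instance Definition _ n := SubType.on (rack_cycle n).
HB.instance Definition _ n := [SubChoice_isSubZmodule of rack_cycle n by <:].

Definition rack_boundary_pred n : {pred rack_cycle n} :=
  fun z => `[< exists c : rack_chain n.+1, rack_boundary c = val z >].

Lemma rack_boundary_zmod_closed n : zmod_closed (@rack_boundary_pred n).
Proof.
split=> [|y z]; rewrite !unfold_in.
  by apply/asboolP; exists 0; rewrite !raddf0.
move=> /asboolP[c cy] /asboolP[d dz]; apply/asboolP.
by exists (c - d); rewrite !raddfB /= cy dz.
Qed.

HB.instance Definition _ n := GRing.isZmodClosed.Build (rack_cycle n)
  (@rack_boundary_pred n) (@rack_boundary_zmod_closed n).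

(* Since n.+1.-1 is convertible to n, this is the group of n-cycles modulo    *)
(* the image of the boundary map from degree n.+1 to degree n.                *)
Definition rack_homology n : zmodType :=
  Quotient.quot (@rack_boundary_pred n).

End RackHomology.

(* Main.v *)
Require Import Defs.
From HB Require Import structures.
From mathcomp Require Import all_boot all_algebra.
From mathcomp Require Import ring boolp freeg.

Set Implicit Arguments.
Unset Strict Implicit.
Unset Printing Implicit Defensive.

Import GRing.Theory.
Local Open Scope ring_scope.

(* Dropping the first entry of a tuple and doubling it both commute with the  *)
(* boundary up to sign, and their composition is the identity; so H_n is a    *)
(* direct summand of H_(n+1) and it suffices to treat n = 3. There, put       *)
(* T_c(x) = sum_i (x, i, i + c) and S_c = sum_x T_c(x). The boundary of sum_i *)
(* (x, i, i + c, y) is T_c(x) - T_(-c)(2 y - x); summing over y shows that p  *)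
(* T_c(0) is homologous to S_(-c), and summing over x that S_c is homologous  *)
(* to S_(-c). The boundary of sum_(x, i) (x, i, i + c, i + d), with 2 c = d = *)
(* -1, then shows that S_(-1) is homologous to S_0. Hence p (T_1(0) - T_0(0)) *)
(* is a boundary, while T_1(0) - T_0(0) itself is not, being detected by      *)
(* Mochizuki's 3-cocycle.                                                     *)

(** The degree shift rests on [boundary_dup_head], [boundary_drop_head] and [drop_headK]. In degree
    3, [shift_sum] is T and [shift_total] is S, and [torsion_cycleMp] makes p (T_1(0) - T_0(0)) a
    boundary. Mochizuki's cocycle is p on this cycle and lies in p^2 Z on all boundaries
    ([mochizuki_torsion_cycle], [mochizuki_cocycle]), so the class has order exactly p. *)

Lemma additive_imageP (U V : zmodType) (f : {additive U -> V}) :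
  exists S : zmodClosed V, forall y, y \in S <-> exists x, f x = y.
Proof.
pose P : {pred V} := fun y => `[< exists x, f x = y >].
have P_closed : zmod_closed P.
  split=> [|y z]; rewrite !unfold_in.
    by apply/asboolP; exists 0; rewrite raddf0.
  move=> /asboolP[u fu] /asboolP[v fv]; apply/asboolP.
  by exists (u - v); rewrite raddfB fu fv.
pose closedP := GRing.isZmodClosed.Build V P P_closed.
pose S : zmodClosed V := HB.pack P closedP.
by exists S => y; rewrite unfold_in; split=> [/asboolP|h]; last exact/asboolP.
Qed.

Lemma Zp_additive_multiples (p : nat) (V : zmodType) (c : V) :
    (1 < p)%N -> c *+ p = 0 ->
  exists f : {additive 'Z_p -> V}, forall a, f a = c *+ (a : nat).
Proof.
move=> p_gt1 cp0; pose f (a : 'Z_p) := c *+ (a : nat).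
have mulrn_mod m : c *+ (m %% p) = c *+ m.
  by rewrite {2}(divn_eq m p) mulrnDr mulnC mulrnA cp0 mul0rn add0r.
have f_morph : nmod_morphism f.
  split=> [|a b]; rewrite /f ?mulr0n //.
  (* Addition in ['Z_p] is modulo [(Zp_trunc p).+2], which is p as 1 < p. *)
  by rewrite -mulrnDr -[RHS]mulrn_mod; congr (_ *+ (_ %% _)); exact: Zp_cast.
pose f_morphP := GRing.isNmodMorphism.Build _ _ f f_morph.
pose F : {additive 'Z_p -> V} := HB.pack f f_morphP.
by exists F.
Qed.

Lemma freeg_additive_ext (K : choiceType) (V : zmodType)
    (f g : {additive {freeg K / int} -> V}) :
  (forall x, f << x >> = g << x >>) -> f =1 g.
Proof.
move=> fg; elim/freeg_ind_dom0 => [|k x D _ _ IHD]; first by rewrite !raddf0.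
by rewrite !raddfD IHD -[k]intz -freegU_mulz !raddfMz fg.
Qed.

(** * Boundaries of rack chains and changing the head of a tuple *)

Section RackChains.
Variable X : rackType.

Lemma face0_ord0 n a (x : n.-tuple X) : face0 ord0 [tuple of a :: x] = x.
Proof. by apply: eq_from_tnth => j; rewrite tnth_mktuple tnthS. Qed.

Lemma face1_ord0 n a (x : n.-tuple X) : face1 ord0 [tuple of a :: x] = x.
Proof. by apply: eq_from_tnth => j; rewrite tnth_mktuple ltn0 tnthS. Qed.

Lemma face0_lift n a (x : n.+1.-tuple X) i :
  face0 (fintype.lift ord0 i) [tuple of a :: x] = [tuple of a :: face0 i x].
Proof.
apply: eq_from_tnth => j; rewrite tnth_mktuple.
case: (unliftP ord0 j) => [k|] ->.
  rewrite tnthS tnth_mktuple -[RHS](tnthS a).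
  by congr tnth; apply: val_inj; rewrite /= /bump /= !add1n ltnS addnS.
by rewrite tnth0 -[RHS](tnth0 a x); congr tnth; apply: val_inj.
Qed.

Lemma face1_lift n a (x : n.+1.-tuple X) i :
  face1 (fintype.lift ord0 i) [tuple of a :: x] =
  [tuple of rack_op a (tnth x i) :: face1 i x].
Proof.
apply: eq_from_tnth => j; rewrite tnth_mktuple tnthS.
case: (unliftP ord0 j) => [k|] ->.
  rewrite tnthS tnth_mktuple -[tnth x (fintype.lift i k)](tnthS a).
  rewrite /= /bump /= !add1n ltnS.
  have -> // : fintype.lift (fintype.lift ord0 i) (fintype.lift ord0 k) =
    fintype.lift ord0 (fintype.lift i k).
    by apply: val_inj; rewrite /= /bump /= !add1n ltnS addnS.
rewrite /= tnth0.
have -> // : fintype.lift (fintype.lift ord0 i) ord0 = ord0 by exact: val_inj.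
Qed.

Lemma rack_boundaryU n (x : n.-tuple X) :
  rack_boundary << x >> = rack_boundary_gen x.
Proof. by rewrite /rack_boundary liftU scale1r. Qed.

(** The head contributes no face, so the sum runs over the positions of the tail; the shift by one
    turns the sign into (-1)^i. *)
Lemma rack_boundary_cons n a (x : n.+1.-tuple X) :
  rack_boundary << [tuple of a :: x] >> =
  \sum_(i < n.+1) (-1) ^+ i *: (<< [tuple of a :: face0 i x] >> -
    << [tuple of rack_op a (tnth x i) :: face1 i x] >>) :> rack_chain X n.+1.
Proof.
rewrite rack_boundaryU /rack_boundary_gen big_mkcond big_ord_recl /= add0r.
apply: eq_bigr => i _; rewrite face0_lift face1_lift.
by rewrite /= !exprS !mulN1r opprK.
Qed.

Definition chain_map m n (f : m.-tuple X -> n.-tuple X) :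
  rack_chain X m -> rack_chain X n := fglift (fun x => << f x >>).

Lemma chain_map_is_zmod_morphism m n (f : m.-tuple X -> n.-tuple X) :
  zmod_morphism (chain_map f).
Proof. exact: lift_is_additive. Qed.

HB.instance Definition _ m n (f : m.-tuple X -> n.-tuple X) :=
  GRing.isZmodMorphism.Build _ _ (chain_map f) (chain_map_is_zmod_morphism f).

Lemma chain_mapU m n (f : m.-tuple X -> n.-tuple X) x :
  chain_map f << x >> = << f x >>.
Proof. by rewrite /chain_map liftU scale1r. Qed.

Lemma chain_mapZ m n (f : m.-tuple X -> n.-tuple X) k c :
  chain_map f (k *: c) = k *: chain_map f c.
Proof. by rewrite -[k]intz !scaler_int raddfMz. Qed.

Lemma chain_map_boundary_cons m n (f : n.+1.-tuple X -> m.-tuple X) a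
    (x : n.+1.-tuple X) :
  chain_map f (rack_boundary << [tuple of a :: x] >>) =
  \sum_(i < n.+1) (-1) ^+ i *: (<< f [tuple of a :: face0 i x] >> -
    << f [tuple of rack_op a (tnth x i) :: face1 i x] >>).
Proof.
rewrite rack_boundary_cons raddf_sum /=; apply: eq_bigr => i _.
by rewrite chain_mapZ raddfB /= !chain_mapU.
Qed.

Definition dup_head n (x : n.+1.-tuple X) : n.+2.-tuple X :=
  [tuple of thead x :: x].

(** The two faces at the copied entry agree since a * a = a; all other positions move by one, which
    flips the sign. *)
Lemma boundary_dup_head n (c : rack_chain X n.+2) :
    (forall a : X, rack_op a a = a) ->
  rack_boundary (chain_map (@dup_head n.+1) c) =
  - chain_map (@dup_head n) (rack_boundary c).
Proof.
move=> idem.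
pose f := @rack_boundary X n.+3 \o chain_map (@dup_head n.+1).
pose g := -%R \o (chain_map (@dup_head n) \o @rack_boundary X n.+2).
apply: (@freeg_additive_ext _ _ f g) => {c} x; rewrite /f /g /=.
case/tupleP: x => a x; rewrite chain_mapU chain_map_boundary_cons.
rewrite /dup_head theadE rack_boundary_cons big_ord_recl expr0 scale1r.
rewrite face0_ord0 face1_ord0 tnth0 idem subrr add0r -sumrN.
apply: eq_bigr => i _; rewrite face0_lift face1_lift tnthS !theadE.
by rewrite exprS mulN1r scaleNr.
Qed.

Definition drop_head n (x : n.+1.-tuple X) : n.-tuple X := [tuple of behead x].

Lemma drop_headE n a (x : n.-tuple X) : drop_head [tuple of a :: x] = x.
Proof. exact: val_inj. Qed.

(** The two faces at the second entry differ only in the head, so they cancel once it is dropped. *)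
Lemma boundary_drop_head n (c : rack_chain X n.+2) :
  rack_boundary (chain_map (@drop_head n.+1) c) =
  - chain_map (@drop_head n) (rack_boundary c).
Proof.
pose f := @rack_boundary X n.+1 \o chain_map (@drop_head n.+1).
pose g := -%R \o (chain_map (@drop_head n) \o @rack_boundary X n.+2).
apply: (@freeg_additive_ext _ _ f g) => {c} x; rewrite /f /g /=.
case/tupleP: x => a x; rewrite chain_mapU chain_map_boundary_cons drop_headE.
rewrite rack_boundaryU /rack_boundary_gen big_mkcond !big_ord_recl /= add0r.
case/tupleP: x => b x; rewrite !drop_headE face0_ord0 face1_ord0 subrr scaler0.
rewrite add0r -sumrN; apply: eq_bigr => i _; rewrite !drop_headE.
by rewrite exprS mulN1r scaleNr.
Qed.

Lemma drop_headK n (c : rack_chain X n.+1) :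
  chain_map (@drop_head n.+1) (chain_map (@dup_head n) c) = c.
Proof.
pose f := chain_map (@drop_head n.+1) \o chain_map (@dup_head n).
apply: (@freeg_additive_ext _ _ f idfun) => {c} x; rewrite /f /= !chain_mapU.
by rewrite drop_headE.
Qed.

End RackChains.

(** * Order p detected by a homomorphism modulo p^2 *)

(* The homomorphism [phi] induces a map from homology to [int] modulo [p ^ 2] *)
(* sending the class of [z] to an element of order [p].                       *)
Definition detected_torsion (X : rackType) (p n : nat) : Prop :=
  exists (z : rack_chain X n) (w : rack_chain X n.+1)
         (phi : {additive rack_chain X n -> int}),
    [/\ rack_boundary z = 0, rack_boundary w = z *+ p, phi z = p%:Z &
        forall c : rack_chain X n.+1, ((p ^ 2)%:Z %| phi (rack_boundary c))%Z].

(** If a z - b z is a boundary, then p^2 divides (a - b) p, so a = b in ['Z_p]. *)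
Lemma detected_torsion_homology (X : rackType) (p n : nat) :
    (1 < p)%N -> detected_torsion X p n ->
  exists f : {additive 'Z_p -> rack_homology X n}, injective f.
Proof.
move=> p_gt1 [z [w [phi [dz dw phiz phid]]]].
have z_cycle : rack_cycle_pred z by exact/eqP.
pose Z : rack_cycle X n := exist _ z z_cycle.
pose c : rack_homology X n := \pi_(rack_homology X n)%qT Z.
have cMn k : c *+ k = \pi_(rack_homology X n)%qT (Z *+ k) by rewrite raddfMn.
have valMn k : val (Z *+ k) = z *+ k by rewrite raddfMn.
have cp0 : c *+ p = 0.
  apply/eqP; rewrite cMn -[0](raddf0 \pi_(rack_homology X n)%qT).
  rewrite -Quotient.idealrBE subr0; apply/asboolP; exists w.
  by rewrite valMn dw.
have [f fE] := Zp_additive_multiples p_gt1 cp0.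
exists f => a b /eqP; rewrite !fE !cMn -Quotient.idealrBE => /asboolP[d dE].
have dE1 : rack_boundary d = z *+ a - z *+ b.
  by rewrite dE -!valMn [LHS](raddfB val).
have := phid d; rewrite dE1 raddfB !raddfMn /= phiz.
have -> : p%:Z *+ a + - p%:Z *+ b = (a%:Z - b%:Z) * p%:Z.
  by rewrite mulNrn !pmulrn !mulrzz; ring.
rewrite expnS expn1 PoszM dvdz_mul2r //; last by rewrite -lt0n ltnW.
have lt_p (u : 'Z_p) : (u < p)%N by rewrite -[ltnRHS]Zp_cast.
rewrite -eqz_mod_dvd !modz_nat eqz_nat !modn_small // => /eqP; exact: val_inj.
Qed.

(** Duplicate the head of [z] and [w], and drop it again before applying [phi]. *)
Lemma detected_torsionS (X : rackType) (p n : nat) :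
    (forall a : X, rack_op a a = a) ->
  detected_torsion X p n.+2 -> detected_torsion X p n.+3.
Proof.
move=> idem [z [w [phi [dz dw phiz phid]]]].
exists (chain_map (@dup_head X n.+1) z), (- chain_map (@dup_head X n.+2) w).
exists (phi \o chain_map (@drop_head X n.+2)); split.
- by rewrite boundary_dup_head // dz raddf0 oppr0.
- by rewrite raddfN /= boundary_dup_head // opprK dw raddfMn.
- by rewrite /= drop_headK.
move=> c /=; rewrite -[chain_map _ _]opprK -boundary_drop_head raddfN.
by rewrite rpredN phid.
Qed.

(** * Mochizuki's cocycle on the dihedral quandle *)

Section DihedralTorsion.
Variable p : nat.
Hypotheses (p_gt1 : (1 < p)%N) (p_odd : odd p).

(** Nested tuples match the form expected by [rack_boundary_cons] and the face lemmas. *)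
Definition cell3 (x y w : 'Z_p) : rack_chain (dihedral p) 3 :=
  << [tuple of (x : dihedral p) ::
      [tuple of (y : dihedral p) :: [tuple of [:: (w : dihedral p)]]]] >>.

Definition cell4 (x y w v : 'Z_p) : rack_chain (dihedral p) 4 :=
  << [tuple of (x : dihedral p) :: [tuple of (y : dihedral p) ::
      [tuple of (w : dihedral p) :: [tuple of [:: (v : dihedral p)]]]]] >>.

Lemma boundary_cell3 x y w : rack_boundary (cell3 x y w) =
  << [tuple of (x : dihedral p) :: [tuple of [:: (w : dihedral p)]]] >> -
  << [tuple of (2 * y - x : dihedral p) ::
      [tuple of [:: (w : dihedral p)]]] >> -
  (<< [tuple of (x : dihedral p) :: [tuple of [:: (y : dihedral p)]]] >> -
   << [tuple of (2 * w - x : dihedral p) ::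
       [tuple of [:: (2 * w - y : dihedral p)]]] >>)
  :> rack_chain (dihedral p) 2.
Proof.
rewrite rack_boundary_cons !big_ord_recl big_ord0 addr0.
rewrite expr0 scale1r expr1 scaleN1r.
by rewrite !(face0_lift, face1_lift, face0_ord0, face1_ord0, tnthS, tnth0).
Qed.

Lemma boundary_cell4 x y w v : rack_boundary (cell4 x y w v) =
  cell3 x w v - cell3 (2 * y - x) w v -
  (cell3 x y v - cell3 (2 * w - x) (2 * w - y) v) +
  (cell3 x y w - cell3 (2 * v - x) (2 * v - y) (2 * v - w)).
Proof.
rewrite rack_boundary_cons !big_ord_recl big_ord0 addr0 addrA.
rewrite expr0 scale1r expr1 scaleN1r sqrrN expr1n scale1r.
by rewrite !(face0_lift, face1_lift, face0_ord0, face1_ord0, tnthS, tnth0).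
Qed.

Definition repr_int (a : 'Z_p) : int := (a : nat)%:Z.

(* The second factor is a multiple of [p], so the first only matters modulo   *)
(* [p]: this is Mochizuki's 3-cocycle, with values in the multiples of [p] in *)
(* [Z / p ^ 2] and with [y ^ p] replaced by the integer representing [y].     *)
Definition mochizuki (x y w : 'Z_p) : int :=
  (repr_int y - repr_int x) *
  (repr_int y + repr_int (2 * w - y) - 2 * repr_int w).

Definition mochizuki_chain : rack_chain (dihedral p) 3 -> int :=
  fglift (fun t : 3.-tuple (dihedral p) =>
    mochizuki (tnth t ord0) (tnth t (fintype.lift ord0 ord0)) (tnth t ord_max)
      : int^o).

Lemma mochizuki_chain_is_zmod_morphism : zmod_morphism mochizuki_chain.
Proof. exact: (@lift_is_additive _ _ int^o). Qed.

HB.instance Definition _ := GRing.isZmodMorphism.Build _ _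
  mochizuki_chain mochizuki_chain_is_zmod_morphism.

Lemma mochizuki_cell3 x y w : mochizuki_chain (cell3 x y w) = mochizuki x y w.
Proof. by rewrite /mochizuki_chain liftU scale1r. Qed.

(** The integer k is the carry; carries make the second factor of [mochizuki] a multiple of p. *)
Lemma repr_int_reflection (a b : 'Z_p) : exists k : int,
  repr_int (2 * b - a) = 2 * repr_int b - repr_int a + k * p%:Z.
Proof.
have : (2 * b - a) + a = b + b by ring.
move=> /(congr1 (@nat_of_ord _)) /eqP; set c := 2 * b - a.
rewrite -[_ == _]/((c + a) %% (Zp_trunc p).+2 == (b + b) %% (Zp_trunc p).+2)%N.
rewrite -eqz_nat -!modz_nat eqz_mod_dvd => /dvdzP[k].
rewrite !PoszD => kE; exists k.
by rewrite -[p%:Z](congr1 Posz (Zp_cast p_gt1)) -kE /repr_int; ring.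
Qed.

Lemma mochizuki_cocycle (c : rack_chain (dihedral p) 4) :
  ((p ^ 2)%:Z %| mochizuki_chain (rack_boundary c))%Z.
Proof.
elim/freeg_ind_dom0: c => [|k t D _ _ IHD]; first by rewrite !raddf0.
rewrite !raddfD /= rpredD // -[k]intz -freegU_mulz !raddfMz /= mulrzz.
apply: dvdz_mulr => {D IHD}.
case/tupleP: t => x t; case/tupleP: t => y t; case/tupleP: t => w t.
case/tupleP: t => v t; rewrite (tuple0 t).
have -> : << [tuple of x :: [tuple of y :: [tuple of w :: [tuple of v ::
    [tuple]]]]] >> = cell4 x y w v by congr << _ >>; exact: val_inj.
rewrite boundary_cell4 !(raddfB, raddfD) /= !mochizuki_cell3 /mochizuki.
(* Self-distributivity: only seven reflections remain. *)
have -> : (2 * (2 * v - w) - (2 * v - y) = 2 * v - (2 * w - y) :> 'Z_p) by ring.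
have [k1 E1] := repr_int_reflection x y.
have [k2 E2] := repr_int_reflection x w.
have [k3 E3] := repr_int_reflection x v.
have [k4 E4] := repr_int_reflection y w.
have [k5 E5] := repr_int_reflection y v.
have [k6 E6] := repr_int_reflection w v.
have [k7 E7] := repr_int_reflection (2 * w - y) v.
rewrite !E7 !E1 !E2 !E3 !E4 !E5 !E6 -mulnn PoszM.
apply/dvdzP.
(* The terms linear in the carries cancel; the witness collects the products of two carries. *)
exists (k1 * k6 + (k4 - k2) * k7 - (k5 - k3) * (k5 - k4 + k7 - 2 * k6)).
ring.
Qed.

(** * Homologies between the chains T and S *)

Definition shift_sum (c x : 'Z_p) := \sum_(i : 'Z_p) cell3 x i (i + c).

Definition shift_total (c : 'Z_p) := \sum_(x : 'Z_p) shift_sum c x.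

Lemma shift_sum_cycle c x : rack_boundary (shift_sum c x) = 0.
Proof.
rewrite raddf_sum /=; under eq_bigr do rewrite boundary_cell3.
rewrite !sumrB.
set A := \sum_i _; set B := \sum_i _; set C := \sum_i _; set D := \sum_i _.
have -> : A = C by rewrite /C (reindex_inj (addIr c)).
have -> : B = D.
  rewrite /B (reindex_inj (addIr c)); apply: eq_bigr => i _.
  by have -> : 2 * (i + c) - i = i + c + c by ring.
by rewrite subrr.
Qed.

(** Translating i by c cancels the first four sums; in the last, reflection in y reverses the
    shift. *)
Lemma boundary_shift_sum c x y :
  rack_boundary (\sum_(i : 'Z_p) cell4 x i (i + c) y) =
  shift_sum c x - shift_sum (- c) (2 * y - x).
Proof.
rewrite raddf_sum /=; under eq_bigr do rewrite boundary_cell4.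
rewrite big_split /= !sumrB.
set A := \sum_i _; set B := \sum_i _; set C := \sum_i _; set D := \sum_i _.
set E := \sum_i cell3 (2 * y - x) _ _.
have -> : A = C by rewrite /C (reindex_inj (addIr c)).
have -> : B = D.
  rewrite /B (reindex_inj (addIr c)); apply: eq_bigr => i _.
  by have -> : 2 * (i + c) - i = i + c + c by ring.
have -> : E = shift_sum (- c) (2 * y - x).
  rewrite /shift_sum (reindex_inj (subrI (2 * y))); apply: eq_bigr => i _.
  by have -> : 2 * y - (i + c) = 2 * y - i - c by ring.
by rewrite subrr add0r.
Qed.

(** For each i, the map x to f i - x permutes ['Z_p], so the reflected head can be replaced by x. *)
Lemma shift_total_reflected (f : 'Z_p -> 'Z_p) (a b : 'Z_p) :
  \sum_(x : 'Z_p) \sum_(i : 'Z_p) cell3 (f i - x) (i + a) (i + b) =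
  shift_total (b - a).
Proof.
rewrite /shift_total /shift_sum exchange_big [RHS]exchange_big.
rewrite [RHS](reindex_inj (addIr a)); apply: eq_bigr => i _.
rewrite [RHS](reindex_inj (subrI (f i))); apply: eq_bigr => x _.
by have -> : i + a + (b - a) = i + b by ring.
Qed.

Lemma boundary_shift_total c d :
  rack_boundary (\sum_(x : 'Z_p) \sum_(i : 'Z_p) cell4 x i (i + c) (i + d)) =
  shift_total (d - 2 * c) - shift_total d + (shift_total c - shift_total (- c)).
Proof.
rewrite raddf_sum /=; under eq_bigr do rewrite raddf_sum /=.
under eq_bigr do under eq_bigr do rewrite boundary_cell4.
under eq_bigr do rewrite big_split /= !sumrB.
rewrite big_split /= !sumrB.
set A := \sum_x \sum_i _; set B := \sum_x \sum_i _.
set C := \sum_x \sum_i _; set D := \sum_x \sum_i _.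
set E := \sum_x \sum_i _; set F := \sum_x \sum_i _.
have -> : A = B.
  rewrite [B]shift_total_reflected /A exchange_big.
  rewrite /shift_total /shift_sum [RHS]exchange_big.
  rewrite [RHS](reindex_inj (addIr c)); apply: eq_bigr => i _.
  by apply: eq_bigr => x _; have -> : i + c + (d - c) = i + d by ring.
have -> : D = shift_total (d - 2 * c).
  rewrite -(shift_total_reflected (fun i => 2 * (i + c))).
  apply: eq_bigr => x _; apply: eq_bigr => i _.
  by congr (cell3 _ _); ring.
have -> : F = shift_total (- c).
  have -> : - c = 2 * d - c - 2 * d by ring.
  rewrite -(shift_total_reflected (fun i => 2 * (i + d))).
  apply: eq_bigr => x _; apply: eq_bigr => i _.
  by congr (cell3 _ _ _); ring.
by rewrite subrr sub0r opprB addrC.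
Qed.

Lemma Zp_unit2 : (2 : 'Z_p) \is a GRing.unit.
Proof. by rewrite unitZpE // coprimen2. Qed.

Lemma sum_shift_sum_double c :
  \sum_(y : 'Z_p) shift_sum c (2 * y - 0) = shift_total c.
Proof.
rewrite /shift_total [RHS](reindex_inj (mulrI Zp_unit2)).
by apply: eq_bigr => y _; rewrite subr0.
Qed.

Definition torsion_cycle := shift_sum 1 0 - shift_sum 0 0.

Lemma torsion_cycleMp : exists w : rack_chain (dihedral p) 4,
  rack_boundary w = torsion_cycle *+ p.
Proof.
pose h : 'Z_p := 2^-1; have h2 : 2 * h = 1 by rewrite mulrV ?Zp_unit2.
pose A c := \sum_(y : 'Z_p) \sum_(i : 'Z_p) cell4 0 i (i + c) y.
have dA c : rack_boundary (A c) = shift_sum c 0 *+ p - shift_total (- c).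
  rewrite raddf_sum /=; under eq_bigr do rewrite boundary_shift_sum.
  by rewrite sumrB sum_shift_sum_double sumr_const card_ord Zp_cast.
(* The choice c = -h, d = -1 gives d - 2 c = 0, so [B] links S_0 to S_(-1); [C] cancels its extra
   S_(-h) - S_h. *)
pose B := \sum_(x : 'Z_p) \sum_(i : 'Z_p) cell4 x i (i - h) (i - 1).
pose C := \sum_(x : 'Z_p) \sum_(i : 'Z_p) cell4 x i (i - h) 0.
have dC : rack_boundary C = shift_total (- h) - shift_total h.
  rewrite raddf_sum /=; under eq_bigr do rewrite boundary_shift_sum opprK.
  rewrite sumrB; congr (_ - _).
  by rewrite /shift_total [RHS](reindex_inj (subrI (2 * 0))).
exists (A 1 - A 0 - B + C).
rewrite raddfD !raddfB /= !dA dC boundary_shift_total opprK.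
have -> : -1 - 2 * - h = 0 by rewrite mulrN h2; ring.
rewrite oppr0 /torsion_cycle mulrnBl !opprB opprD -[LHS]addrA subrK opprB.
by rewrite [LHS]addrAC [X in X + _ = _]addrA subrK addrA subrK.
Qed.

(** * Evaluation of the cocycle on the torsion cycle *)

(** The second difference vanishes except where it wraps around: i = q gives -q (q + 2) and i = q +
    1 gives (q + 1) (q + 2). *)
Lemma sum_cyclic_second_difference q :
  \sum_(i < q.+2) i%:Z *
    (i%:Z + (((i + 2) %% q.+2)%N)%:Z - 2 * (((i + 1) %% q.+2)%N)%:Z) =
  q.+2%:Z.
Proof.
have PoszS m : m.+1%:Z = m%:Z + 1 by rewrite -addn1 PoszD.
rewrite !big_ord_recr big1 => [|[i ltiq] _] /=.
  rewrite addn2 modnn addn1 modn_small //.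
  have -> : (q.+1 + 2 = q.+2 + 1)%N by rewrite addn1 addn2.
  rewrite (addn1 q.+1) modnn modnDl modn_small //.
  by rewrite (PoszS q.+1) (PoszS q); ring.
rewrite !modn_small ?addn2 ?addn1 ?ltnS //; last by rewrite ltnW.
by rewrite (PoszS i.+1) (PoszS i); ring.
Qed.

(** T_0 contributes 0 because i reflected in i is i; in T_1, i reflected in i + 1 is i + 2, which
    yields a cyclic second difference. *)
Lemma mochizuki_torsion_cycle : mochizuki_chain torsion_cycle = p%:Z.
Proof.
rewrite raddfB /=.
have -> : mochizuki_chain (shift_sum 0 0) = 0.
  rewrite raddf_sum /=; apply: big1 => i _; rewrite mochizuki_cell3 /mochizuki.
  rewrite [i + 0]addr0; have -> : 2 * i - i = i by ring.
  ring.
rewrite subr0 raddf_sum -[p%:Z](congr1 Posz (Zp_cast p_gt1)) /=.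
rewrite -sum_cyclic_second_difference; apply: eq_bigr => i _.
rewrite mochizuki_cell3 /mochizuki subr0.
have -> : 2 * (i + 1) - i = i + 1 + 1 by ring.
have repr1 (a : 'Z_p) : repr_int (a + 1) = ((a + 1) %% (Zp_trunc p).+2)%N by [].
by rewrite !repr1 [nat_of_ord (i + 1)]/= modnDml -addnA.
Qed.

Lemma dihedral_detected_torsion n : detected_torsion (dihedral p) p n.+3.
Proof.
elim: n => [|n IHn].
  have [w dw] := torsion_cycleMp.
  exists torsion_cycle, w, mochizuki_chain; split=> //.
  - by rewrite raddfB /= !shift_sum_cycle subrr.
  - exact: mochizuki_torsion_cycle.
  - exact: mochizuki_cocycle.
apply: detected_torsionS IHn => a.
by rewrite -[LHS]/(2 * (a : 'Z_p) - (a : 'Z_p)); ring.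
Qed.

End DihedralTorsion.

Theorem mainTheorem2 (p : nat) (p_prime : prime p) (p_odd : odd p)
    (n : nat) (n_ge3 : (3 <= n)%N) :
  exists (S : zmodClosed (rack_homology (dihedral p) n))
         (f : {additive 'Z_p -> rack_homology (dihedral p) n}),
    injective f /\ (forall y, y \in S <-> exists x, f x = y).
Proof.
have p_gt1 := prime_gt1 p_prime.
case: n n_ge3 => [|[|[|n]]] // _.
have [f f_inj] :=
  detected_torsion_homology p_gt1 (dihedral_detected_torsion p_gt1 p_odd n).
by have [S SP] := additive_imageP f; exists S, f.
Qed.
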